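(* Let $(\mathfrak g,\cdot)$ be a commutative associative algebra and let $D_1,D_2,D_3$ be derivations of $(\mathfrak g,\cdot)$ with $D_iD_j=D_jD_i$ for $i,j=1,2,3$. Let $N$ be a Nijenhuis operator on $(\mathfrak g,\cdot)$ satisfying $ND_i=D_iN$ for $i=1,2,3$. Then $N$ is a Nijenhuis operator on the $3$-Lie algebra $\mathfrak g$ with bracket $$[x,y,z]=\begin{vmatrix}D_1(x)&D_1(y)&D_1(z)\\ D_2(x)&D_2(y)&D_2(z)\\ D_3(x)&D_3(y)&D_3(z)\end{vmatrix},\qquad x,y,z\in\mathfrak g.$$
   Context: The determinant of a $3\times3$ matrix with entries in the commutative associative algebra $(\mathfrak g,\cdot)$ is given by the usual formula using the product of $\mathfrak g$. A linear map $N$ on an associative algebra $(\mathfrak g,\cdot)$ is a Nijenhuis operator if $Nx\cdot Ny=N(Nx\cdot y+x\cdot Ny-N(x\cdot y))$ for all $x,y\in\mathfrak g$. A $3$-Lie algebra is a vector space $\mathfrak g$ with a trilinear skew-symmetric bracket satisfying $[x_1,x_2,[y_1,y_2,y_3]]=[[x_1,x_2,y_1],y_2,y_3]+[y_1,[x_1,x_2,y_2],y_3]+[y_1,y_2,[x_1,x_2,y_3]]$. It is a known fact that the bracket in the claim is a $3$-Lie algebra structure. A linear map $N$ on a $3$-Lie algebra is a Nijenhuis operator if $[Nx,Ny,Nz]=N([x,y,z]_N^2)$ for all $x,y,z$, where $[x,y,z]_N^1=[Nx,y,z]+[x,Ny,z]+[x,y,Nz]-N[x,y,z]$ and $[x,y,z]_N^2=[Nx,Ny,z]+[x,Ny,Nz]+[Nx,y,Nz]-N([x,y,z]_N^1)$.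 *)

(* Defs.v *)
From HB Require Import structures.
From mathcomp Require Import all_boot all_order all_algebra.
From mathcomp Require Import ring.
Set Implicit Arguments.
Unset Strict Implicit.
Unset Printing Implicit Defensive.
Import GRing.Theory.
Local Open Scope ring_scope.

(* The algebra is not assumed to have a unit, so MathComp's algebra structures
   (all unital) do not apply. *)
Structure comAssocAlgebra (K : fieldType) := ComAssocAlgebra {
  caa_sort :> lmodType K;
  caa_mul : {bilinear caa_sort -> caa_sort -> caa_sort};
  caa_mulA : associative caa_mul;
  caa_mulC : commutative caa_mul
}.

Declare Scope caa_scope.
Delimit Scope caa_scope with caa.
Notation "x ** y" := (caa_mul _ x y)
  (at level 40, left associativity) : caa_scope.
Local Open Scope caa_scope.

Definition derivation (K : fieldType) (g : comAssocAlgebra K)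
    (D : {linear g -> g}) : Prop :=
  forall x y : g, D (x ** y) = D x ** y + x ** D y.

Definition nijenhuis_alg (K : fieldType) (g : comAssocAlgebra K)
    (N : {linear g -> g}) : Prop :=
  forall x y : g, N x ** N y = N (N x ** y + x ** N y - N (x ** y)).

(* [\det] requires a unital ring of coefficients; this is the same Leibniz
   formula in size 3, with the product of [g]. *)
Definition det3 (K : fieldType) (g : comAssocAlgebra K) (M : 'M[g]_3) : g :=
    M 0 0 ** M 1 1 ** M 2 2 + M 0 1 ** M 1 2 ** M 2 0
  + M 0 2 ** M 1 0 ** M 2 1 - M 0 2 ** M 1 1 ** M 2 0
  - M 0 1 ** M 1 0 ** M 2 2 - M 0 0 ** M 1 2 ** M 2 1.

(* The two transpositions in [skew12] and [skew23] generate the symmetric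
   group on the three arguments. *)
Record is_threeLie (K : fieldType) (V : lmodType K) (br : V -> V -> V -> V)
    : Prop := IsThreeLie {
  tl_linear1 : forall y z, linear (fun x => br x y z);
  tl_linear2 : forall x z, linear (fun y => br x y z);
  tl_linear3 : forall x y, linear (br x y);
  tl_skew12 : forall x y z, br y x z = - br x y z;
  tl_skew23 : forall x y z, br x z y = - br x y z;
  tl_fundamental : forall x1 x2 y1 y2 y3,
    br x1 x2 (br y1 y2 y3)
    = br (br x1 x2 y1) y2 y3 + br y1 (br x1 x2 y2) y3 + br y1 y2 (br x1 x2 y3)
}.

Structure threeLieAlgebra (K : fieldType) := ThreeLieAlgebra {
  tl_sort :> lmodType K;
  tl_bracket : tl_sort -> tl_sort -> tl_sort -> tl_sort;
  tl_axioms : is_threeLie tl_bracket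
}.

Definition bracketN1 (K : fieldType) (L : threeLieAlgebra K)
    (N : {linear L -> L}) (x y z : L) : L :=
  let br := @tl_bracket K L in
  br (N x) y z + br x (N y) z + br x y (N z) - N (br x y z).

Definition bracketN2 (K : fieldType) (L : threeLieAlgebra K)
    (N : {linear L -> L}) (x y z : L) : L :=
  let br := @tl_bracket K L in
  br (N x) (N y) z + br x (N y) (N z) + br (N x) y (N z)
  - N (bracketN1 N x y z).

Definition nijenhuis_3Lie (K : fieldType) (L : threeLieAlgebra K)
    (N : {linear L -> L}) : Prop :=
  forall x y z : L, tl_bracket (N x) (N y) (N z) = N (bracketN2 N x y z).

Definition det_bracket (K : fieldType) (g : comAssocAlgebra K)
    (D : 'I_3 -> {linear g -> g}) (x y z : g) : g :=
  det3 (\matrix_(i < 3, j < 3) D i (tnth [tuple x; y; z] j)).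

(* Unitization [K * g] of [g], which embeds [g] in a commutative ring; it is
   only used to prove that [det_bracket] satisfies the fundamental identity. *)
Definition unitization (K : fieldType) (g : comAssocAlgebra K) : Type :=
  (K * g)%type.

HB.instance Definition _ (K : fieldType) (g : comAssocAlgebra K) :=
  GRing.Zmodule.copy (unitization g) (K * g)%type.

Definition un_one (K : fieldType) (g : comAssocAlgebra K) : unitization g :=
  (1, 0).

Definition un_mul (K : fieldType) (g : comAssocAlgebra K)
    (u v : unitization g) : unitization g :=
  (u.1 * v.1, u.1 *: v.2 + v.1 *: u.2 + u.2 ** v.2).

Lemma un_mulC (K : fieldType) (g : comAssocAlgebra K) :
  commutative (@un_mul K g).
Proof.
move=> [a u] [b v]; rewrite /un_mul /=.
by rewrite mulrC caa_mulC [a *: v + _]addrC.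
Qed.

Lemma un_mulA (K : fieldType) (g : comAssocAlgebra K) :
  associative (@un_mul K g).
Proof.
move=> [a u] [b v] [c w]; rewrite /un_mul /= mulrA; congr pair.
rewrite !linearDr !linearDl !linearZr_LR !linearZl_LR /= caa_mulA.
rewrite !scalerDr !scalerA [c * a]mulrC [c * b]mulrC -!addrA.
congr (_ + (_ + _)).
rewrite addrCA; congr (_ + _); rewrite [RHS]addrCA; congr (_ + _).
exact: addrCA.
Qed.

Lemma un_mul1 (K : fieldType) (g : comAssocAlgebra K) :
  left_id (un_one g) (@un_mul K g).
Proof.
by move=> [a u]; rewrite /un_mul /= mul1r scale1r scaler0 linear0l !addr0.
Qed.

Lemma un_mulDl (K : fieldType) (g : comAssocAlgebra K) :
  left_distributive (@un_mul K g) +%R.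
Proof.
move=> [a u] [b v] [c w]; rewrite /un_mul /=.
congr pair; first exact: mulrDl.
rewrite /= linearDl scalerDl scalerDr /= -!addrA; congr (_ + _).
rewrite addrCA; congr (_ + _); rewrite [RHS]addrCA; congr (_ + _).
exact: addrCA.
Qed.

HB.instance Definition _ (K : fieldType) (g : comAssocAlgebra K) :=
  GRing.Zmodule_isComPzRing.Build (unitization g)
    (@un_mulA K g) (@un_mulC K g) (@un_mul1 K g) (@un_mulDl K g).

Definition un_inj (K : fieldType) (g : comAssocAlgebra K) (x : g) :
  unitization g := (0, x).

Lemma un_injI (K : fieldType) (g : comAssocAlgebra K) : injective (@un_inj K g).
Proof. by move=> x y []. Qed.

Lemma un_injD (K : fieldType) (g : comAssocAlgebra K) (x y : g) :
  un_inj (x + y) = un_inj x + un_inj y.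
Proof. by rewrite /un_inj; congr pair; rewrite addr0. Qed.

Lemma un_injN (K : fieldType) (g : comAssocAlgebra K) (x : g) :
  un_inj (- x) = - un_inj x.
Proof. by rewrite /un_inj; congr pair; rewrite oppr0. Qed.

Lemma un_injM (K : fieldType) (g : comAssocAlgebra K) (x y : g) :
  un_inj (x ** y) = un_inj x * un_inj y.
Proof.
by rewrite /un_inj; congr pair; rewrite /= ?mul0r // !scale0r !add0r.
Qed.

Lemma un_injZ (K : fieldType) (g : comAssocAlgebra K) (a : K) (x : g) :
  un_inj (a *: x) = ((a, 0) : unitization g) * un_inj x.
Proof.
by rewrite /un_inj; congr pair; rewrite /= ?mulr0 // scaler0 linear0l !addr0.
Qed.

Definition un_injE := (un_injD, un_injN, un_injM, un_injZ).

Lemma det_bracketE (K : fieldType) (g : comAssocAlgebra K)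
    (D : 'I_3 -> {linear g -> g}) (x y z : g) :
  det_bracket D x y z =
    D 0 x ** D 1 y ** D 2 z + D 0 y ** D 1 z ** D 2 x
  + D 0 z ** D 1 x ** D 2 y - D 0 z ** D 1 y ** D 2 x
  - D 0 y ** D 1 x ** D 2 z - D 0 x ** D 1 z ** D 2 y.
Proof. by rewrite /det_bracket /det3 !mxE. Qed.

(* The fundamental identity in a commutative ring: [f i] stands for [D i] and
   [h i j] for [D i \o D j]; [dbr i] is [D i] of the bracket. *)
Lemma fundamental_ring (R : comPzRingType) (T : Type)
    (f : 'I_3 -> T -> R) (h : 'I_3 -> 'I_3 -> T -> R)
    (h10 : h 1 0 =1 h 0 1) (h20 : h 2 0 =1 h 0 2) (h21 : h 2 1 =1 h 1 2) :
  let det a0 b0 c0 a1 b1 c1 a2 b2 c2 : R :=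
    a0 * b1 * c2 + b0 * c1 * a2 + c0 * a1 * b2
    - c0 * b1 * a2 - b0 * a1 * c2 - a0 * c1 * b2 in
  let dbr i x y z :=
    det (h i 0 x) (h i 0 y) (h i 0 z) (f 1 x) (f 1 y) (f 1 z)
        (f 2 x) (f 2 y) (f 2 z)
    + det (f 0 x) (f 0 y) (f 0 z) (h i 1 x) (h i 1 y) (h i 1 z)
        (f 2 x) (f 2 y) (f 2 z)
    + det (f 0 x) (f 0 y) (f 0 z) (f 1 x) (f 1 y) (f 1 z)
        (h i 2 x) (h i 2 y) (h i 2 z) in
  forall x1 x2 y1 y2 y3,
    det (f 0 x1) (f 0 x2) (dbr 0 y1 y2 y3) (f 1 x1) (f 1 x2) (dbr 1 y1 y2 y3)
        (f 2 x1) (f 2 x2) (dbr 2 y1 y2 y3)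
    = det (dbr 0 x1 x2 y1) (f 0 y2) (f 0 y3) (dbr 1 x1 x2 y1) (f 1 y2) (f 1 y3)
          (dbr 2 x1 x2 y1) (f 2 y2) (f 2 y3)
      + det (f 0 y1) (dbr 0 x1 x2 y2) (f 0 y3)
          (f 1 y1) (dbr 1 x1 x2 y2) (f 1 y3)
          (f 2 y1) (dbr 2 x1 x2 y2) (f 2 y3)
      + det (f 0 y1) (f 0 y2) (dbr 0 x1 x2 y3)
          (f 1 y1) (f 1 y2) (dbr 1 x1 x2 y3)
          (f 2 y1) (f 2 y2) (dbr 2 x1 x2 y3).
Proof.
move=> det dbr x1 x2 y1 y2 y3; rewrite /dbr !(h10, h20, h21) /det.
ring.
Qed.

Lemma un_inj_det (K : fieldType) (g : comAssocAlgebra K)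
    (D : 'I_3 -> {linear g -> g}) (x y z : g) :
  let f i u : unitization g := un_inj (D i u) in
  un_inj (det_bracket D x y z) =
    f 0 x * f 1 y * f 2 z + f 0 y * f 1 z * f 2 x
  + f 0 z * f 1 x * f 2 y - f 0 z * f 1 y * f 2 x
  - f 0 y * f 1 x * f 2 z - f 0 x * f 1 z * f 2 y.
Proof. by rewrite det_bracketE !un_injE. Qed.

Lemma un_inj_ddet (K : fieldType) (g : comAssocAlgebra K)
    (D : 'I_3 -> {linear g -> g}) (derD : forall i, derivation (D i))
    (i : 'I_3) (x y z : g) :
  let f i u : unitization g := un_inj (D i u) in
  let h i j u : unitization g := un_inj (D i (D j u)) in
  let det a0 b0 c0 a1 b1 c1 a2 b2 c2 : unitization g :=
    a0 * b1 * c2 + b0 * c1 * a2 + c0 * a1 * b2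
    - c0 * b1 * a2 - b0 * a1 * c2 - a0 * c1 * b2 in
  un_inj (D i (det_bracket D x y z)) =
    det (h i 0 x) (h i 0 y) (h i 0 z) (f 1 x) (f 1 y) (f 1 z)
        (f 2 x) (f 2 y) (f 2 z)
    + det (f 0 x) (f 0 y) (f 0 z) (h i 1 x) (h i 1 y) (h i 1 z)
        (f 2 x) (f 2 y) (f 2 z)
    + det (f 0 x) (f 0 y) (f 0 z) (f 1 x) (f 1 y) (f 1 z)
        (h i 2 x) (h i 2 y) (h i 2 z).
Proof.
have DM u v : D i (u ** v) = D i u ** v + u ** D i v by exact: derD.
have DB a b c d u v : D i (a + b + c - d - u - v)
    = D i a + D i b + D i c - D i d - D i u - D i v.
  by rewrite !raddfB !raddfD.
rewrite /= det_bracketE DB !DM !un_injE; ring.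
Qed.

Lemma det_bracket_threeLie (K : fieldType) (g : comAssocAlgebra K)
    (D : 'I_3 -> {linear g -> g}) (derD : forall i, derivation (D i))
    (commD : forall i j, D i \o D j =1 D j \o D i) :
  is_threeLie (det_bracket D).
Proof.
split.
- move=> y z a x x'; rewrite !det_bracketE !linearP.
  by apply: un_injI; rewrite !un_injE; ring.
- move=> x z a y y'; rewrite !det_bracketE !linearP.
  by apply: un_injI; rewrite !un_injE; ring.
- move=> x y a z z'; rewrite !det_bracketE !linearP.
  by apply: un_injI; rewrite !un_injE; ring.
- move=> x y z; rewrite !det_bracketE.
  by apply: un_injI; rewrite !un_injE; ring.
- move=> x y z; rewrite !det_bracketE.
  by apply: un_injI; rewrite !un_injE; ring.
- move=> x1 x2 y1 y2 y3.
  apply: un_injI; rewrite [RHS]un_injD [X in _ = X + _]un_injD.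
  rewrite !un_inj_det !(un_inj_ddet derD).
  apply: (@fundamental_ring _ _ (fun i u => un_inj (D i u))
            (fun i j u => un_inj (D i (D j u)))) => u;
    by congr un_inj; apply: commD.
Qed.

Definition det_threeLie (K : fieldType) (g : comAssocAlgebra K)
    (D : 'I_3 -> {linear g -> g}) (derD : forall i, derivation (D i))
    (commD : forall i j, D i \o D j =1 D j \o D i) : threeLieAlgebra K :=
  ThreeLieAlgebra (det_bracket_threeLie derD commD).

(* Main.v *)
(* Iterating the Nijenhuis identity of the commutative algebra on a product of
   three factors gives
     Na Nb Nc = N (Na Nb c + a Nb Nc + Na b Nc - N (Na b c + a Nb c + a b Nc - N (abc))),
   which is the 3-Lie Nijenhuis identity for the trilinear map abc. As N commutes
   with the D_i, the identity for the bracket is the alternating sum of this one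
   over the six monomials of the determinant. *)
Require Import Defs.
From mathcomp Require Import all_boot all_order all_algebra.
From mathcomp Require Import ring.
Import GRing.Theory.
Local Open Scope ring_scope.
Local Open Scope caa_scope.

Lemma nijenhuis_alg3 (K : fieldType) (g : comAssocAlgebra K)
    (N : {linear g -> g}) (nijN : nijenhuis_alg N) (a b c : g) :
  N a ** N b ** N c =
    N (N a ** N b ** c + a ** N b ** N c + N a ** b ** N c
       - N (N a ** b ** c + a ** N b ** c + a ** b ** N c - N (a ** b ** c))).
Proof.
have Nab := nijN a b; set u := (X in _ = N X) in Nab.
(* As [N a ** N b] is the single image [N u], the identity applies to [u] and [c], then to [a ** b]
   and [c]. The two terms [N (N (a ** b) ** c)] under the outer [N] cancel. *)
rewrite [in LHS]Nab [LHS]nijN -Nab /u !(linearDl, linearNl) /= (nijN (a ** b)).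
have ND : {morph N : u v / u + v} := raddfD N.
have NN : {morph N : u / - u} := raddfN N.
(* Only additive bookkeeping remains; it moves to the unitization, where [ring] applies. *)
rewrite !(ND, NN); apply: un_injI; rewrite !(un_injD, un_injN); ring.
Qed.

Theorem proposition4p9 (K : fieldType) (g : comAssocAlgebra K)
  (D : 'I_3 -> {linear g -> g})
  (derD : forall i, derivation (D i))
  (commD : forall i j, D i \o D j =1 D j \o D i)
  (N : {linear g -> g})
  (nijN : nijenhuis_alg N)
  (commND : forall i, N \o D i =1 D i \o N) :
  @nijenhuis_3Lie K (det_threeLie derD commD) N.
Proof.
have DN i u : D i (N u) = N (D i u) by rewrite -[LHS]/((D i \o N) u) -commND.
pose br := det_bracket D.
(* The goal is convertible to this form on [g], which exposes the product to rewriting. *)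
suff E (x y z : g) : br (N x) (N y) (N z) =
    N (br (N x) (N y) z + br x (N y) (N z) + br (N x) y (N z)
       - N (br (N x) y z + br x (N y) z + br x y (N z) - N (br x y z))).
  exact: E.
have ND : {morph N : u v / u + v} := raddfD N.
have NN : {morph N : u / - u} := raddfN N.
rewrite /br !det_bracketE !DN !(nijenhuis_alg3 _ _ _ nijN) !(ND, NN).
by apply: un_injI; rewrite !(un_injD, un_injN); ring.
Qed.
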